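(* Let $I$ be a problem with agents $N$, contracts $E$ and Plott choice functions $C_a$, let $0\in N$ be an agent with $C_0=C_1*C_2$ for Plott choice functions $C_1,C_2$ on $E(0)$, and let $\widetilde I$ be the modified problem with projection $\pi:\widetilde E\to E$ (described in the context). Then for every stable set $\widetilde S$ of $\widetilde I$ the set $\pi(\widetilde S)$ is stable in $I$, and the map $\pi_*:\mathbf{St}(\widetilde I)\to\mathbf{St}(I)$, $\widetilde S\mapsto\pi(\widetilde S)$, is a bijection, where $\mathbf{St}$ denotes the set of stable sets.
   Context: All sets are finite. A choice function (CF) on a set $X$ is a map $C:2^X\to 2^X$ with $C(A)\subseteq A$. It is a Plott CF if it is consistent ($C(A)\subseteq B\subseteq A\Rightarrow C(B)=C(A)$) and substitutable ($B\subseteq A\Rightarrow C(A)\cap B\subseteq C(B)$). For CFs $F,G$ on the same set, $(F*G)(A)=F(A)\cup G(A\setminus F(A))$. A problem consists of a finite set $N$ of agents, a finite set $E$ of contracts, for each $e\in E$ a set $P(e)\subseteq N$ of participants, and for each $a\in N$ a Plott CF $C_a$ on $E(a)=\{e\in E: a\in P(e)\}$. For $S\subseteq E$ write $S(a)=S\cap E(a)$. $S$ is stable if (1) $C_a(S(a))=S(a)$ for all $a\in N$, and (2) every $e\in E$ such that $e\in C_a(S(a)\cup\{e\})$ for all $a\in P(e)$ belongs to $S$. Modified problem $\widetilde I$: Let $M=N\setminus\{0\}$, $R=E\setminus E(0)$. Contracts: $\widetilde E=R\sqcup\{e_1: e\in E(0)\}\sqcup\{e_2:e\in E(0)\}$ (two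 disjoint copies of $E(0)$), with $\pi:\widetilde E\to E$ given by $\pi(r)=r$ for $r\in R$ and $\pi(e_i)=e$. Agents: $1,2$ and $\widetilde m$ for each $m\in M$. Participants: for $r\in R$, $\{\widetilde m: m\in P(r)\}$; for $e_i$, $\{i\}\cup\{\widetilde m: m\in P(e)\setminus\{0\}\}$. Thus $\widetilde E(i)=\{e_i:e\in E(0)\}$ and $\widetilde E(\widetilde m)=\pi^{-1}(E(m))$. The CF of agent $i\in\{1,2\}$ is $\widetilde C_i(B)=\{e_i: e\in C_i(\pi(B))\}$. The CF of $\widetilde m$ is: for $B\subseteq\widetilde E(\widetilde m)$, $\widetilde C_{\widetilde m}(B)$ consists, for each $x\in C_m(\pi(B))$, of the single element $x$ if $x\in R$, and, if $x\in E(0)$, of $x_1$ when $x_1\in B$ and of $x_2$ otherwise.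
   Formalization: The formal theorem additionally assumes that every contract in E(0) has a participant other than agent 0; without this the claim fails, since the two copies of a contract with P(e)={0} share no agent and can both lie in a stable set. *)

(* Defs.v *)
From HB Require Import structures.
From mathcomp Require Import all_boot.

Set Implicit Arguments.
Unset Strict Implicit.
Unset Printing Implicit Defensive.

(* A choice function on [X : {set T}] is encoded as a total map on [{set T}] of
   which only the values at subsets of [X] are ever constrained or used. *)
Section ChoiceFunctions.
Variable T : finType.
Implicit Types (X A B : {set T}) (C F G : {set T} -> {set T}).

Definition choice_function X C := forall A, A \subset X -> C A \subset A.

Definition consistent X C :=
  forall A B, A \subset X -> C A \subset B -> B \subset A -> C B = C A.

Definition substitutable X C :=
  forall A B, A \subset X -> B \subset A -> C A :&: B \subset C B.

Definition plott X C :=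
  [/\ choice_function X C, consistent X C & substitutable X C].

Definition cf_eq X F G := forall A, A \subset X -> F A = G A.

Definition cf_star F G A := F A :|: G (A :\: F A).

End ChoiceFunctions.

Definition contracts_at (N E : finType) (P : E -> {set N}) (a : N) : {set E} :=
  [set e | a \in P e].

Record problem := Problem {
  agent : finType;
  contract : finType;
  participants : contract -> {set agent};
  cf : agent -> {set contract} -> {set contract};
  cf_plott : forall a, plott (contracts_at participants a) (cf a)
}.

Definition contracts_of (I : problem) (a : agent I) : {set contract I} :=
  contracts_at (@participants I) a.

Definition restr (I : problem) (S : {set contract I}) (a : agent I) :=
  S :&: contracts_of a.

Definition stable (I : problem) (S : {set contract I}) : bool :=
  [forall a, cf a (restr S a) == restr S a] &&
  [forall e, [forall a in participants e, e \in cf a (restr S a :|: [set e])]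
               ==> (e \in S)].

Definition stable_set (I : problem) := {S : {set contract I} | stable S}.

Section Modified.
Variables (I : problem) (o : agent I) (C1 C2 : {set contract I} -> {set contract I}).

(* The labels 1 and 2, of both the two new agents and the two copies of E(o),
   are encoded as [true] and [false] respectively. *)
Definition mod_contract : finType :=
  ({e : contract I | e \notin contracts_of o}
   + bool * {e : contract I | e \in contracts_of o})%type.

Definition mod_agent : finType := (bool + {m : agent I | m != o})%type.

Definition mod_proj (x : mod_contract) : contract I :=
  match x with inl r => val r | inr (_, e) => val e end.

Definition mod_participants (x : mod_contract) : {set mod_agent} :=
  match x with
  | inl r => [set inr m | m : {m | m != o} & val m \in participants (val r)]
  | inr (i, e) =>
      inl i |: [set inr m | m : {m | m != o} & val m \in participants (val e)]
  end.

Definition mod_cf (a : mod_agent) (B : {set mod_contract}) : {set mod_contract} :=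
  match a with
  | inl i =>
      [set x : mod_contract | if x is inr (j, e) then
         (j == i) && (val e \in (if i then C1 else C2) (mod_proj @: B))
       else false]
  | inr m =>
      [set x : mod_contract | (mod_proj x \in cf (val m) (mod_proj @: B)) &&
         match x with
         | inl _ => true
         | inr (true, e) => inr (true, e) \in B
         | inr (false, e) => inr (true, e) \notin B
         end]
  end.

Lemma contracts_at_copy (i : bool) :
  contracts_at mod_participants (inl i)
  = [set x | if x is inr (j, _) then j == i else false].
Proof.
apply/setP=> -[r|[j e]]; rewrite !inE.
  by apply/negbTE/imsetP=> -[].
have -> : (inl i == inl j :> mod_agent) = (j == i) by rewrite eq_sym.
by case: eqP => //= _; apply/negbTE/imsetP=> -[].
Qed.

Lemma contracts_at_tilde (m : {m : agent I | m != o}) :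
  contracts_at mod_participants (inr m) = mod_proj @^-1: contracts_of (val m).
Proof.
have inr_inj : injective (inr : _ -> mod_agent) by move=> ? ? [].
by apply/setP=> -[r|[j e]]; rewrite !inE ?(mem_imset _ _ inr_inj) ?inE.
Qed.

Hypothesis plott1 : plott (contracts_of o) C1.
Hypothesis plott2 : plott (contracts_of o) C2.

Lemma mod_cf_plott a : plott (contracts_at mod_participants a) (mod_cf a).
Proof.
case: a => [i|m].
- have [] : plott (contracts_of o) (if i then C1 else C2) by case: i.
  set C := (if i then _ else _) => Ccf Ccons Csub.
  have piX (B : {set mod_contract}) :
      B \subset contracts_at mod_participants (inl i) ->
      mod_proj @: B \subset contracts_of o.
    rewrite contracts_at_copy => /subsetP sB.
    apply/subsetP=> _ /imsetP[x /sB xB ->].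
    by move: x xB => [r|[j e]]; [rewrite inE | move=> _; exact: (valP e)].
  have piI (B : {set mod_contract}) e :
      B \subset contracts_at mod_participants (inl i) ->
      val e \in mod_proj @: B -> inr (i, e) \in B.
    rewrite contracts_at_copy => /subsetP sB /imsetP[[r|[j e']] xB] /=.
      by have := sB _ xB; rewrite inE.
    by move=> /val_inj ->; have := sB _ xB; rewrite inE => /eqP <-.
  have piC (B : {set mod_contract}) :
      B \subset contracts_at mod_participants (inl i) ->
      mod_proj @: mod_cf (inl i) B = C (mod_proj @: B).
    move=> sB; apply/setP=> y; apply/imsetP/idP => [[[r|[j e]]] | yC].
    + by rewrite inE.
    + by rewrite inE => /andP[_ eC] ->.
    + have yo : y \in contracts_of o.
        exact: subsetP (piX _ sB) _ (subsetP (Ccf _ (piX _ sB)) _ yC).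
      by exists (inr (i, Sub y yo)); rewrite //= inE eqxx.
  split.
  + move=> B sB; apply/subsetP=> -[r|[j e]]; rewrite inE //.
    move=> /andP[/eqP-> eC]; apply: piI => //.
    exact: subsetP (Ccf _ (piX _ sB)) _ eC.
  + move=> A B sA sCB sBA.
    have CE : C (mod_proj @: B) = C (mod_proj @: A).
      by apply: Ccons; rewrite ?piX ?imsetS // -piC ?imsetS.
    by apply/setP=> -[r|[j e]]; rewrite !inE // -/C CE.
  + move=> A B sA sBA; apply/subsetP=> -[r|[j e]]; rewrite !inE //.
    case/andP=> /andP[-> eC] eB /=.
    apply: (subsetP (Csub _ _ (piX _ sA) (imsetS mod_proj sBA))).
    by rewrite inE eC; apply/imsetP; exists (inr (j, e)).
- have [Ccf Ccons Csub] := cf_plott (val m).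
  rewrite -/(contracts_of _) in Ccf Ccons Csub.
  have piX (B : {set mod_contract}) :
      B \subset contracts_at mod_participants (inr m) ->
      mod_proj @: B \subset contracts_of (val m).
    by rewrite contracts_at_tilde sub_imset_pre.
  have Tcf : choice_function (contracts_at mod_participants (inr m))
                             (mod_cf (inr m)).
    move=> B sB; apply/subsetP=> x; rewrite inE => /andP[xC].
    have /imsetP[y yB] := subsetP (Ccf _ (piX _ sB)) _ xC.
    move: x y yB {xC} => [r|[j e]] [r'|[j' e']] yB /=.
    + by move=> /val_inj ->.
    + by move=> rE; have := valP r; rewrite /= rE (valP e').
    + by move=> eE; have := valP r'; rewrite /= -eE (valP e).
    + by move=> /val_inj eE; subst e'; case: j j' yB => [] [] // ->.
  have piC (B : {set mod_contract}) :
      B \subset contracts_at mod_participants (inr m) ->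
      mod_proj @: mod_cf (inr m) B = cf (val m) (mod_proj @: B).
    move=> sB; apply/setP=> y; apply/imsetP/idP => [[x] | yC].
      by rewrite inE => /andP[xC _] ->.
    have /imsetP[[r|[j e]] xB yE] := subsetP (Ccf _ (piX _ sB)) _ yC.
      by exists (inl r) => //; rewrite inE -yE yC.
    have [e1B|e1B] := boolP (inr (true, e) \in B).
      by exists (inr (true, e)) => //; rewrite inE /= -[val e]yE yC.
    by exists (inr (false, e)) => //; rewrite inE /= -[val e]yE yC.
  split=> //.
  + move=> A B sA sCB sBA.
    have CE : cf (val m) (mod_proj @: B) = cf (val m) (mod_proj @: A).
      by apply: Ccons; rewrite ?piX ?imsetS // -piC ?imsetS.
    have key e : val e \in cf (val m) (mod_proj @: A) ->
        (inr (true, e) \in B) = (inr (true, e) \in A).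
      move=> eC; apply/idP/idP => [/(subsetP sBA) // | e1A].
      by apply: (subsetP sCB); rewrite inE eC.
    apply/setP=> -[r|[[] e]]; rewrite !inE CE //=;
      by case: (boolP (val e \in _)) => //= /key ->.
  + move=> A B sA sBA; apply/subsetP=> x; rewrite !inE.
    case/andP=> /andP[xC xA] xB; apply/andP; split.
      apply: (subsetP (Csub _ _ (piX _ sA) (imsetS mod_proj sBA))).
      by rewrite inE xC; apply/imsetP; exists x.
    move: x xA xB {xC} => [r|[[] e]] // e1A _.
    by apply: contra e1A; apply: (subsetP sBA).
Qed.

Definition modified : problem := Problem mod_cf_plott.

End Modified.

(* Main.v *)
Require Import Defs.
From HB Require Import structures.
From mathcomp Require Import all_boot.

Set Implicit Arguments.
Unset Strict Implicit.
Unset Printing Implicit Defensive.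

(** Let [T] be stable in the modified problem, let [S] be its projection, and let
    [T_i] be the set of contracts that [T] holds with label [i].  An agent other
    than [o] never holds both copies of a contract, and stability against
    deviations to label 1 forces [T_1 = C1 (restr S o)].  Hence
    [T_2 = restr S o :\: C1 (restr S o)], so [T] is determined by [S]; conversely
    this labelling of a stable [S] is stable. *)

(** * Preliminaries on Plott choice functions and stability *)

Lemma notin_subset (T : finType) (A X : {set T}) (x : T) :
  x \notin X -> A \subset X -> (x \in A) = false.
Proof. by move=> xX sA; apply: contraNF xX; apply: (subsetP sA). Qed.

(** If [x] is rejected, the choice from [A :|: [set x]] already lies in [A], so consistency lets [x]
    be dropped. *)
Lemma plott_reject (T : finType) (X A : {set T}) (C : {set T} -> {set T}) (x : T) :
  plott X C -> A \subset X -> x \in X -> x \notin C (A :|: [set x]) ->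
  C (A :|: [set x]) = C A.
Proof.
move=> [Ccf Ccons _] sA xX xC; symmetry.
have sAx : A :|: [set x] \subset X by rewrite subUset sA sub1set.
apply: Ccons => //; last exact: subsetUl.
apply/subsetP=> y yC; have := subsetP (Ccf _ sAx) _ yC.
by rewrite !inE => /orP[//|/eqP yx]; rewrite yx (negbTE xC) in yC *.
Qed.

Lemma plott_idem (T : finType) (X A : {set T}) (C : {set T} -> {set T}) :
  plott X C -> A \subset X -> C (C A) = C A.
Proof. by move=> [Ccf Ccons _] sA; apply: Ccons => //; apply: Ccf. Qed.

Lemma stableP (I : problem) (S : {set contract I}) :
  reflect ((forall a, cf a (restr S a) = restr S a) /\
           (forall e, (forall a, a \in participants e ->
                         e \in cf a (restr S a :|: [set e])) -> e \in S))
          (stable S).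
Proof.
apply: (iffP andP) => -[H1 H2]; split.
- by move=> a; apply/eqP; apply: (forallP H1).
- move=> e He; apply: (implyP (forallP H2 e)); apply/forallP=> a.
  by apply/implyP; apply: He.
- by apply/forallP=> a; rewrite H1.
- apply/forallP=> e; apply/implyP=> /forallP He; apply: H2 => a.
  exact: (implyP (He a)).
Qed.

Lemma in_restr (I : problem) (S : {set contract I}) a e :
  (e \in restr S a) = (e \in S) && (a \in participants e).
Proof. by rewrite !inE. Qed.

(** * Choices in the modified problem, expressed through the projection *)

Section Modified.
Variables (I : problem) (o : agent I) (C1 C2 : {set contract I} -> {set contract I}).
Hypotheses (plott1 : plott (contracts_of o) C1)
           (plott2 : plott (contracts_of o) C2).

Let J := modified plott1 plott2.
Let pi : mod_contract o -> contract I := @mod_proj I o.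
Let Ci (i : bool) := if i then C1 else C2.
Implicit Types (S : {set contract I}) (T : {set contract J}).

Let plotti i : plott (contracts_of o) (Ci i).
Proof. by case: i. Qed.

Lemma restr_sub S : restr S o \subset contracts_of o.
Proof. exact: subsetIr. Qed.

Lemma tilde_participant (m : {m | m != o}) (x : contract J) :
  (inr m \in @participants J x) = (val m \in participants (pi x)).
Proof. by have := contracts_at_tilde m => /setP/(_ x); rewrite !inE. Qed.

Lemma copy_participant i j e :
  (inl i \in @participants J (inr (j, e))) = (j == i).
Proof. by have := contracts_at_copy o i => /setP/(_ (inr (j, e))); rewrite !inE. Qed.

Lemma copy_participant_inl i r : (inl i \in @participants J (inl r)) = false.
Proof. by have := contracts_at_copy o i => /setP/(_ (inl r)); rewrite !inE. Qed.

Lemma in_restr_mod T a (x : contract J) :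
  (x \in @restr J T a) = (x \in T) && (a \in @participants J x).
Proof. exact: in_restr. Qed.

(** This is [T_i], with labels erased so that [Ci i] applies to it directly. *)
Definition copy i T : {set contract I} := pi @: @restr J T (inl i).

Lemma in_copy i T e : (val e \in copy i T) = (inr (i, e) \in T).
Proof.
apply/imsetP/idP => [[[r|[j e']]]|eS].
- by rewrite in_restr_mod copy_participant_inl andbF.
- by rewrite in_restr_mod copy_participant => /andP[eS /eqP <-] /val_inj ->.
- by exists (inr (i, e)); rewrite // in_restr_mod copy_participant eS eqxx.
Qed.

Lemma copy_sub i T : copy i T \subset contracts_of o.
Proof.
apply/subsetP=> _ /imsetP[[r|[j e]] + ->]; last by move=> _; apply: (valP e).
by rewrite in_restr_mod copy_participant_inl andbF.
Qed.

Lemma proj_tilde T (m : {m | m != o}) :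
  pi @: @restr J T (inr m) = restr (pi @: T) (val m).
Proof.
apply/setP=> y; rewrite in_restr; apply/imsetP/andP.
  move=> [x]; rewrite in_restr_mod tilde_participant => /andP[xS mx] ->.
  by split=> //; apply: imset_f.
by move=> [/imsetP[x xS ->] mx]; exists x; rewrite // in_restr_mod xS tilde_participant.
Qed.

Lemma proj_copies T : restr (pi @: T) o = copy true T :|: copy false T.
Proof.
apply/setP=> y; rewrite in_restr in_setU; apply/andP/idP.
  move=> [/imsetP[[r|[j e]] xS ->]] yo.
    by have := valP r; rewrite /= inE yo.
  by rewrite !in_copy; case: j xS {yo} => ->; rewrite ?orbT.
case/orP=> y_i; (split; last by have := subsetP (copy_sub _ _) _ y_i; rewrite inE);
  by apply: (subsetP (imsetS pi _)) y_i; apply: subsetIl.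
Qed.

Lemma cf_copyE i (B : {set contract J}) j e :
  (inr (j, e) \in @cf J (inl i) B) = (j == i) && (val e \in Ci i (pi @: B)).
Proof. by rewrite inE. Qed.

Lemma cf_tildeE m (B : {set contract J}) (x : contract J) :
  (x \in @cf J (inr m) B) =
  (pi x \in cf (val m) (pi @: B)) &&
  match x with
  | inr (false, e) => inr (true, e) \notin B
  | inr (true, e) => inr (true, e) \in B
  | inl _ => true
  end.
Proof. by rewrite inE; case: x => [r|[[] e]]. Qed.

Lemma copy_dev i T e :
  (inr (i, e) \in @cf J (inl i) (@restr J T (inl i) :|: [set inr (i, e)]))
  = (val e \in Ci i (copy i T :|: [set val e])).
Proof. by rewrite cf_copyE eqxx imsetU imset_set1. Qed.

(** Label 1 wins every tie, so labels matter only for a deviation to label 2, which fails when the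
    label-1 copy is already held. *)
Lemma tilde_dev T (m : {m | m != o}) (x : contract J) :
  val m \in participants (pi x) ->
  (x \in @cf J (inr m) (@restr J T (inr m) :|: [set x]))
  = (pi x \in cf (val m) (restr (pi @: T) (val m) :|: [set pi x])) &&
    (if x is inr (false, e) then inr (true, e) \notin T else true).
Proof.
move=> mx; rewrite cf_tildeE imsetU imset_set1 proj_tilde; congr (_ && _).
case: x mx => [r|[[] e]] //= mx; first by rewrite !inE eqxx orbT.
by rewrite in_setU in_restr_mod tilde_participant mx andbT inE orbF.
Qed.

Lemma copy_fixedP i T :
  (@cf J (inl i) (@restr J T (inl i)) == @restr J T (inl i))
  = (Ci i (copy i T) == copy i T).
Proof.
have [Ccf _ _] := plotti i.
apply/eqP/eqP => [/setP fixS|fixS].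
  apply/setP=> y; have [yo|yo] := boolP (y \in contracts_of o); last first.
    by rewrite !(notin_subset yo) ?copy_sub //; apply: subset_trans (Ccf _ _) _; apply: copy_sub.
  have := fixS (inr (i, Sub y yo)).
  by rewrite cf_copyE eqxx in_restr_mod copy_participant eqxx andbT -in_copy.
apply/setP=> -[r|[j e]]; first by rewrite in_restr_mod copy_participant_inl andbF inE.
rewrite cf_copyE in_restr_mod copy_participant -/(copy i T) fixS in_copy andbC.
by case: eqP => [->|]; rewrite ?andbF.
Qed.

(** If [o] were the sole participant of a contract, no agent would be left to rule out holding both
    of its copies. *)
Hypothesis not_alone : forall e, e \in contracts_of o ->
  exists2 m, m \in participants e & m != o.

Lemma tilde_mate (e : {e | e \in contracts_of o}) :
  exists m : {m | m != o}, val m \in participants (val e).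
Proof. by have [m mP mo] := not_alone (valP e); exists (Sub m mo). Qed.

(** * Projection of a stable set *)

Section StableProjection.
Variable T : {set contract J}.
Hypothesis stT : stable T.

Let fixT a : @cf J a (@restr J T a) = @restr J T a.
Proof. by have /stableP[] := stT. Qed.

(** Another participant of [e] would see both copies and drop the one with label 2, contradicting
    that a stable [T] is fixed by every agent's choice. *)
Lemma copies_disjoint e : inr (true, e) \in T -> inr (false, e) \notin T.
Proof.
move=> e1; apply/negP=> e2; have [m mP] := tilde_mate e.
have : inr (false, e) \in @restr J T (inr m) by rewrite in_restr_mod e2 tilde_participant.
by rewrite -fixT cf_tildeE in_restr_mod e1 tilde_participant mP andbF.
Qed.

Lemma proj_tilde_fixed (m : {m | m != o}) :
  cf (val m) (restr (pi @: T) (val m)) = restr (pi @: T) (val m).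
Proof.
have [Ccf _ _] := cf_plott (val m).
apply/eqP; rewrite eqEsubset Ccf ?subsetIr //=; apply/subsetP=> y.
rewrite -proj_tilde => /imsetP[x xS ->].
by move: xS; rewrite -{1}fixT cf_tildeE => /andP[].
Qed.

Lemma copy_fixed i : Ci i (copy i T) = copy i T.
Proof. by apply/eqP; rewrite -copy_fixedP fixT. Qed.

Lemma copy_in i e :
  (if i then true else inr (true, e) \notin T) ->
  val e \in Ci i (copy i T :|: [set val e]) ->
  (forall m : {m | m != o}, val m \in participants (val e) ->
     val e \in cf (val m) (restr (pi @: T) (val m) :|: [set val e])) ->
  inr (i, e) \in T.
Proof.
move=> ei eC em; have /stableP[_] := stT; apply=> -[j|m].
  by rewrite copy_participant => /eqP <-; rewrite copy_dev.
by rewrite tilde_participant => mP; rewrite tilde_dev // em //; case: i ei eC.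
Qed.

(* A contract [e] labelled 2 that [C1] would select from [restr S o], for
   [S] the projection of [T], would also be accepted with label 1, its other
   participants only caring about [e]. *)
Lemma copy_true : copy true T = C1 (restr (pi @: T) o).
Proof.
have [Ccf Ccons Csub] := plott1.
have sS1 : copy true T \subset restr (pi @: T) o by rewrite proj_copies subsetUl.
(* Given this inclusion, consistency makes the choices of [C1] from [restr (pi @: T) o] and from
   [copy true T] agree, and the latter is [copy true T] itself. *)
suff sC : C1 (restr (pi @: T) o) \subset copy true T.
  by rewrite -(Ccons _ _ (restr_sub _) sC sS1) [C1 _](copy_fixed true).
apply/subsetP=> y yC; have yS := subsetP (Ccf _ (restr_sub _)) _ yC.
pose e : {e | e \in contracts_of o} := Sub y (subsetP (restr_sub _) _ yS).
rewrite -[y]/(val e) in yC *; rewrite in_copy; apply: copy_in => // [|m mP].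
  apply: (subsetP (Csub _ (copy true T :|: [set val e]) (restr_sub (pi @: T)) _)).
    by rewrite subUset sS1 sub1set.
  by rewrite in_setI yC !inE eqxx orbT.
have eS : val e \in restr (pi @: T) (val m).
  by rewrite in_restr mP andbT; have := yS; rewrite in_restr => /andP[].
by rewrite (setUidPl _) ?sub1set // proj_tilde_fixed.
Qed.

(** The two copies cover [restr (pi @: T) o] and are disjoint, so removing the first leaves the
    second. *)
Lemma copy_false : copy false T = restr (pi @: T) o :\: C1 (restr (pi @: T) o).
Proof.
rewrite -copy_true proj_copies setDUl setDv set0U; symmetry; apply/setDidPl.
rewrite disjoint_subset; apply/subsetP=> y y2.
pose e : {e | e \in contracts_of o} := Sub y (subsetP (copy_sub _ _) _ y2).
rewrite inE; apply/negP; rewrite -[y]/(val e) in_copy => /copies_disjoint.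
by rewrite -in_copy y2.
Qed.

Hypothesis cf_o : cf_eq (contracts_of o) (cf o) (cf_star C1 C2).

(** For [o], the two stages of [C1 * C2] return exactly [T_1] and [T_2]. A contract blocking the
    projection gives a blocking copy, labelled by the stage that accepts it. *)
Lemma proj_stable : stable (pi @: T).
Proof.
have [_ _ C1sub] := plott1.
apply/stableP; split=> [a|y yC].
  have [->|ao] := eqVneq a o; last exact: (proj_tilde_fixed (Sub a ao)).
  rewrite cf_o ?restr_sub // /cf_star -copy_false -copy_true [C2 _](copy_fixed false).
  by rewrite proj_copies.
have [//|yS] := boolP (y \in pi @: T).
have [yo|yo] := boolP (y \in contracts_of o); last first.
  pose r : {e | e \notin contracts_of o} := Sub y yo.
  suff rS : inl r \in T by case/negP: yS; apply/imsetP; exists (inl r).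
  have /stableP[_] := stT; apply=> -[j|m]; first by rewrite copy_participant_inl.
  by rewrite tilde_participant => mP; rewrite tilde_dev // andbT; apply: yC.
pose e : {e | e \in contracts_of o} := Sub y yo.
have eS i : inr (i, e) \notin T.
  by apply: contra yS => eS; apply/imsetP; exists (inr (i, e)).
(* The other participants accept [y] by [yC], and neither copy is in [T]; so acceptance by agent [i]
   alone would make copy [i] block [T]. *)
have yE i : val e \in Ci i (copy i T :|: [set val e]) -> false.
  move=> eC; suff : inr (i, e) \in T by rewrite (negbTE (eS _)).
  by apply: copy_in => // [|m /yC //]; rewrite eS; case: (i).
have sSy : restr (pi @: T) o :|: [set y] \subset contracts_of o.
  by rewrite subUset restr_sub sub1set.
have oy : o \in participants y by have := yo; rewrite inE.
have := yC o oy; rewrite cf_o // in_setU.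
(* If [C1] accepts [y], substitutability carries this down to [copy true T :|: [set y]]. *)
have [y1|y1] := boolP (y \in C1 (restr (pi @: T) o :|: [set y])) => /= yoC.
  apply: (yE true); have := subsetP (C1sub _ (copy true T :|: [set y]) sSy _) y.
  by rewrite in_setI y1 !inE eqxx orbT; apply=> //; rewrite proj_copies setSU ?subsetUl.
apply: (yE false); move: yoC.
(* A rejected [y] leaves the choice of [C1] unchanged, so [C2] is offered exactly [T_2] together
   with [y]. *)
rewrite (plott_reject plott1) ?restr_sub // -copy_true setDUl copy_true -copy_false.
suff -> : [set y] :\: C1 (restr (pi @: T) o) = [set y] by [].
by apply/setDidPl; rewrite disjoints1 -copy_true -[y]/(val e) in_copy.
Qed.

End StableProjection.

(** * Lifting a stable set, and the inverse of the projection *)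

Definition mod_lift S : {set contract J} :=
  [set x : contract J | (pi x \in S) &&
     (if x is inr (i, e) then (val e \in C1 (restr S o)) == i else true)].

Lemma proj_lift S : pi @: mod_lift S = S.
Proof.
apply/setP=> y; apply/imsetP/idP=> [[x]|yS]; first by rewrite inE => /andP[? _] ->.
have [yo|yo] := boolP (y \in contracts_of o).
  (* The truth value of membership in [C1 (restr S o)] serves as the label, [true] standing for
     1. *)
  by exists (inr (y \in C1 (restr S o), Sub y yo)); rewrite // inE yS /=.
by exists (inl (Sub y yo)); rewrite // inE yS.
Qed.

Lemma copy_lift i S :
  copy i (mod_lift S) = if i then C1 (restr S o) else restr S o :\: C1 (restr S o).
Proof.
have [Ccf _ _] := plott1; have sC := Ccf _ (restr_sub S).
have sub : (if i then C1 (restr S o) else restr S o :\: C1 (restr S o))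
           \subset restr S o by case: i; rewrite ?subsetDl.
apply/setP=> y; have [yo|yo] := boolP (y \in contracts_of o); last first.
  by rewrite !(notin_subset yo) ?copy_sub // (subset_trans sub) ?restr_sub.
pose e : {e | e \in contracts_of o} := Sub y yo.
rewrite -[y]/(val e) in_copy inE /=.
case: i {sub}; last first.
  by rewrite in_setD in_restr andbC; have := yo; rewrite inE => ->; rewrite andbT eqbF_neg.
rewrite eqb_id andbC; case: (boolP (y \in C1 _)) => //= /(subsetP sC).
by rewrite in_restr => /andP[].
Qed.

Lemma lift_proj T : stable T -> mod_lift (pi @: T) = T.
Proof.
move=> stT; apply/setP=> -[r|[i e]].
  rewrite inE andbT; apply/imsetP/idP=> [[[r'|[j e]] xS]|rS].
  - by move=> /val_inj ->.
  - by move=> rE; have := valP r; rewrite [val r]rE (valP e).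
  - by exists (inl r).
rewrite -[LHS]in_copy -[RHS]in_copy copy_lift.
by case: i; rewrite ?copy_true ?copy_false.
Qed.

Hypothesis cf_o : cf_eq (contracts_of o) (cf o) (cf_star C1 C2).

Lemma lift_fixed S a :
  stable S -> @cf J a (@restr J (mod_lift S) a) = @restr J (mod_lift S) a.
Proof.
move=> /stableP[fixS _]; case: a => [i|m].
  apply/eqP; rewrite copy_fixedP copy_lift; case: i; apply/eqP.
    exact: (plott_idem plott1 (restr_sub S)).
  have [C2cf _ _] := plott2.
  have s2 : restr S o :\: C1 (restr S o) \subset contracts_of o.
    by rewrite (subset_trans _ (restr_sub S)) ?subsetDl.
  (* Since [o] keeps all of [restr S o], whatever [C1] rejects there must be chosen by [C2]. *)
  apply/eqP; rewrite eqEsubset C2cf //=; apply/subsetP=> y.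
  rewrite in_setD => /andP[/negbTE y1]; have := fixS o.
  by rewrite cf_o ?restr_sub // => {1}<-; rewrite in_setU y1.
(* For the remaining agents the lift holds just one copy of each contract, so the tie-breaking rule
   reproduces its labels. *)
apply/setP=> x; rewrite cf_tildeE proj_tilde proj_lift fixS in_restr in_restr_mod.
rewrite tilde_participant inE.
case: (boolP (val m \in _)) => mx; last by rewrite !andbF.
rewrite !andbT; case: (boolP (pi x \in S)) => // xS /=.
case: x mx xS => [//|[[] e]] mx xS; rewrite in_restr_mod inE tilde_participant mx xS !andbT //.
by rewrite eqb_id eqbF_neg.
Qed.

(** If all participants accept the copy [x], stability of [S] first puts its projection in [S]; then
    the label of [x] is shown to be the one that the lift assigns. *)
Lemma lift_stable S : stable S -> stable (mod_lift S).
Proof.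
move=> stS; have /stableP[fixS blockS] := stS.
apply/stableP; split=> [a|x xC]; first exact: lift_fixed.
have xm m : m \in participants (pi x) -> m != o ->
    (pi x \in cf m (restr S m :|: [set pi x])) &&
    (if x is inr (false, e) then inr (true, e) \notin mod_lift S else true).
  move=> mx mo; pose m' : {m | m != o} := Sub m mo.
  have := xC (inr m'); rewrite tilde_participant => /(_ mx).
  by rewrite tilde_dev // proj_lift.
case: x xC xm => [r|[i e]] xC xm.
  rewrite inE andbT; apply: blockS => m mr.
  have mo : m != o by apply: contra (valP r) => /eqP mo; rewrite mo in mr; rewrite inE.
  by have /andP[] := xm m mr mo.
have := xC (inl i); rewrite copy_participant eqxx copy_dev => /(_ isT).
rewrite copy_lift => {xC} eC.
have [C1cf C1cons _] := plott1.
have sC := C1cf _ (restr_sub S).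
have sSe : restr S o :|: [set val e] \subset contracts_of o.
  by rewrite subUset restr_sub sub1set (valP e).
have eo : o \in participants (val e) by have := valP e; rewrite inE.
(* Were [e] rejected from [restr S o :|: [set e]], it would by consistency be
   rejected from the smaller [C1 (restr S o) :|: [set e]]. *)
have e1C : i -> val e \in C1 (restr S o :|: [set val e]).
  move=> ii; rewrite ii in eC; apply: contraLR eC => e1.
  have E := plott_reject plott1 (restr_sub S) (valP e) e1.
  rewrite /Ci (C1cons _ _ sSe) // ?setSU // E; exact: subsetUl.
have eS : val e \in S.
  apply: blockS => m me; have [->|mo] := eqVneq m o; last by have /andP[] := xm m me mo.
  (* If [C1] rejects [e], the label is 2 by [e1C], and the second stage of [o] faces the same set as
     agent 2, who accepts. *)
  rewrite cf_o // in_setU; case: (boolP (_ \in C1 _)) => //= e1.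
  have E := plott_reject plott1 (restr_sub S) (valP e) e1; rewrite E.
  have in1 : i = false by apply: contraNF e1.
  rewrite in1 in eC; rewrite setDUl.
  suff -> : [set val e] :\: C1 (restr S o) = [set val e] by [].
  by apply/setDidPl; rewrite disjoints1 -E.
rewrite inE [pi _]/(val e) eS /=.
(* With label 1, adding [e] to [restr S o] changes nothing, so [C1] selects [e] there. With label 2,
   acceptance by another participant shows that the label-1 copy is not in the lift, hence that [C1]
   does not select [e]. *)
case: i eC e1C xm => [_ /(_ isT) + _|_ _ xm].
  by rewrite (setUidPl _) ?sub1set ?in_restr ?eS // => ->.
have [m me] := tilde_mate e; have /andP[_] := xm _ me (valP m).
by rewrite inE [pi _]/(val e) eS eqbF_neg eqb_id.
Qed.

End Modified.

Theorem theorem2 (I : problem) (o : agent I)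
    (C1 C2 : {set contract I} -> {set contract I})
    (plott1 : plott (contracts_of o) C1)
    (plott2 : plott (contracts_of o) C2)
    (cf_o : cf_eq (contracts_of o) (cf o) (cf_star C1 C2))
    (not_alone : forall e, e \in contracts_of o ->
       exists2 m, m \in participants e & m != o) :
  exists pi_stable :
      forall S : {set contract (modified plott1 plott2)},
        stable S -> stable (@mod_proj I o @: S),
    bijective (fun S : stable_set (modified plott1 plott2) =>
      exist _ (@mod_proj I o @: sval S) (pi_stable (sval S) (svalP S))
      : stable_set I).
Proof.
exists (fun S stS => proj_stable not_alone stS cf_o).
exists (fun S : stable_set I =>
  exist _ (mod_lift plott1 plott2 (sval S))
    (lift_stable plott1 plott2 not_alone cf_o (svalP S))
  : stable_set (modified plott1 plott2)) => -[S stS]; apply: val_inj => /=.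
  exact: lift_proj.
exact: proj_lift.
Qed.
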